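(* Let $m\ge 1$ and let $G=(V,E)$ be the graph given by $m$ disjoint copies of $K_3$ (cliques of size $3$). Consider the maximum independent set problem on $G$, formulated as maximizing $\sum_{v\in V}x_v$ over $x\in C\cap S$ with $C=P(G)$ and $S=\mathbb{Z}^{3m}$, and let $\mathcal{D}$ be the family of all variable disjunctions. Then there is a cutting plane algorithm based on $\mathcal{D}$ which solves this problem in $m$ iterations, but any branch-and-bound proof based on $\mathcal{D}$ certifying an upper bound of $m$ on the optimal value (i.e., any branch-and-bound proof of $\sum_{v\in V}x_v\le m$) has size at least $2^{m+1}-2$, for all $m\geq 1$.
   Context: $P(G):=\{x\in\mathbb{R}^V: x_u+x_v\le 1\ \forall (u,v)\in E,\ x\in[0,1]^V\}$; independent sets correspond to integer points of $P(G)$. A valid disjunction for a closed set $S\subseteq\mathbb{R}^n$ is a finite union $D=Q_1\cup\dots\cup Q_k$ of closed convex sets with $S\subseteq D$. The variable disjunctions are $D_{i,K}=\{x\in\mathbb{R}^n: x_i\le K\}\cup\{x\in\mathbb{R}^n: x_i\ge K+1\}$, $i\in\{1,\dots,n\}$, $K\in\mathbb{Z}$. A cutting plane for a convex set $C$ derived from $D$ is a halfspace $H$ with $C\cap D\subseteq H$. Cutting plane algorithm based on $\mathcal{D}$ (for $\sup\{\langle c,x\rangle: x\in C\cap S\}$): start with $C_0:=C$. For $i=0,1,\dots$: find $x^i\in\arg\max\{\langle c,x\rangle: x\in C_i\}$ (stop if $C_i=\emptyset$ or if no maximizer exists); if $x^i\in S$, report $x^i$ as optimal and stop; otherwise choose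 $D\in\mathcal{D}$ and a cutting plane $H$ for $C_i$ derived from $D$ with $x^i\notin H$, and set $C_{i+1}:=C_i\cap H$ (stop if there is none). A specific strategy for the choices gives a specific algorithm. A branch-and-bound (BB) proof based on $\mathcal{D}$ of an inequality $\langle c,x\rangle\le\gamma$ valid for $C\cap S$ is a rooted tree whose nodes represent convex subsets of $C$, whose root represents $C$, such that for each non-leaf node representing $C'$ there is $D=Q_1\cup\dots\cup Q_k\in\mathcal{D}$ so that its children represent $C'\cap Q_1,\dots,C'\cap Q_k$, and such that $\langle c,x\rangle\le\gamma$ is valid for all sets represented by leaves. Its size is the number of nodes minus 1. *)

(* Defs.v *)
From HB Require Import structures.
From mathcomp Require Import all_boot all_order all_algebra.
From mathcomp Require Import all_classical all_reals all_analysis.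
From mathcomp Require Import lra.

Set Implicit Arguments.
Unset Strict Implicit.
Unset Printing Implicit Defensive.

Import Order.TTheory GRing.Theory Num.Theory.
Import numFieldNormedType.Exports.

Local Open Scope classical_set_scope.
Local Open Scope ring_scope.

Section Geometry.
Context {R : realType} {n : nat}.
Implicit Types (c x : 'rV[R]_n) (C S : set 'rV[R]_n).

Definition dotp c x : R := \sum_(i < n) c 0 i * x 0 i.

Definition argmax c C : set 'rV[R]_n :=
  [set x | C x /\ forall y, C y -> dotp c y <= dotp c x].

Definition valid_ineq c (gamma : R) C : Prop :=
  forall x, C x -> dotp c x <= gamma.

Definition is_halfspace (H : set 'rV[R]_n) : Prop :=
  exists a : 'rV[R]_n, exists b : R, a != 0 /\ H = [set x | dotp a x <= b].

Definition int_points : set 'rV[R]_n := [set x | forall i, x 0 i \is a Num.int].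

End Geometry.

Arguments int_points : clear implicits.

(* A finite union D is kept as the list of its pieces Q_1, ..., Q_k, since
   branching depends on the pieces and not only on their union. *)
Definition union_of (T : Type) (Qs : seq (set T)) : set T :=
  \big[setU/set0]_(Q <- Qs) Q.

Record disjunction (R : realType) (n : nat) (S : set 'rV[R]_n) := Disjunction {
  pieces : seq (set 'rV[R]_n);
  pieces_closed_convex :
    forall Q, Q \in pieces -> closed Q /\ convex_set Q;
  pieces_cover : S `<=` union_of pieces }.

Section VariableDisjunctions.
Context {R : realType} {n : nat}.

Definition variable_pieces (i : 'I_n) (K : int) : seq (set 'rV[R]_n) :=
  [:: [set x : 'rV[R]_n | x 0 i <= K%:~R];
      [set x : 'rV[R]_n | (K + 1)%:~R <= x 0 i]].

Lemma variable_pieces_closed_convex i K (Q : set 'rV[R]_n) :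
  Q \in variable_pieces i K -> closed Q /\ convex_set Q.
Proof.
have coordC : continuous (fun x : 'rV[R]_n => x 0 i) by exact: coord_continuous.
rewrite !inE => /orP[]/eqP ->; split.
- exact: (preimage_closed (fun x _ => coordC x) (closed_le (y := K%:~R))).
- apply/convex_setW => x y; rewrite !inE /= => xK yK l l0 l1; rewrite inE /=.
  have -> : conv l x y 0 i = l%:num * x 0 i + (1 - l%:num) * y 0 i.
    by rewrite !mxE.
  by nra.
- exact: (preimage_closed (fun x _ => coordC x) (closed_ge (y := (K + 1)%:~R))).
- apply/convex_setW => x y; rewrite !inE /= => xK yK l l0 l1; rewrite inE /=.
  have -> : conv l x y 0 i = l%:num * x 0 i + (1 - l%:num) * y 0 i.
    by rewrite !mxE.
  by nra.
Qed.

Lemma variable_pieces_cover i K :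
  int_points R n `<=` union_of (variable_pieces i K).
Proof.
move=> x /(_ i) /Num.Theory.intrP[z xz].
rewrite /union_of /variable_pieces !big_cons big_nil setU0 /= xz !ler_int.
by case: (lerP z K) => zK; [left | right; rewrite /= lezD1].
Qed.

Definition variable_disjunction (i : 'I_n) (K : int) :
    disjunction (int_points R n) :=
  Disjunction (@variable_pieces_closed_convex i K) (@variable_pieces_cover i K).

Definition variable_disjunctions : set (disjunction (int_points R n)) :=
  [set D | exists i, exists K, D = variable_disjunction i K].

End VariableDisjunctions.

Arguments variable_disjunctions : clear implicits.

(* The problem is sup { <c, x> : x in C `&` S }, with disjunctions from DD. *)
Section CuttingPlanes.
Context {R : realType} {n : nat} (S : set 'rV[R]_n).
Variable DD : set (disjunction S).
Variables (c : 'rV[R]_n) (C : set 'rV[R]_n).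

Definition cutting_plane (C' : set 'rV[R]_n) (D : disjunction S)
    (H : set 'rV[R]_n) : Prop :=
  is_halfspace H /\ C' `&` union_of (pieces D) `<=` H.

Record iteration := Iteration {
  it_point : 'rV[R]_n;
  it_disj : disjunction S;
  it_cut : set 'rV[R]_n }.

(* The set C_i reached after the iterations recorded in h (oldest first). *)
Definition relaxation (h : seq iteration) : set 'rV[R]_n :=
  foldl (fun C' it => C' `&` it_cut it) C h.

Definition admissible_cut (C' : set 'rV[R]_n) (x : 'rV[R]_n)
    (D : disjunction S) (H : set 'rV[R]_n) : Prop :=
  [/\ DD D, cutting_plane C' D H & ~ H x].

(* A strategy makes all the choices left open by the generic algorithm,
   including that of a maximizer; it may use the whole past of the run. *)
Record cp_strategy := CPStrategy {
  choose_point : seq iteration -> 'rV[R]_n;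
  choose_cut : seq iteration -> 'rV[R]_n -> disjunction S * set 'rV[R]_n }.

Definition follows_rules (A : cp_strategy) : Prop :=
  forall h : seq iteration,
    (argmax c (relaxation h) !=set0 ->
       argmax c (relaxation h) (choose_point A h)) /\
    (forall x, argmax c (relaxation h) x -> ~ S x ->
       (exists D, exists H, admissible_cut (relaxation h) x D H) ->
       admissible_cut (relaxation h) x
         (choose_cut A h x).1 (choose_cut A h x).2).

(* [reports A h k x]: started from the past h, A performs k further
   iterations, each adding a cut, and then stops reporting x.  The
   unsuccessful stops have no constructor. *)
Inductive reports (A : cp_strategy) : seq iteration -> nat -> 'rV[R]_n -> Prop :=
| reports_stop h :
    argmax c (relaxation h) (choose_point A h) -> S (choose_point A h) ->
    reports A h 0 (choose_point A h)
| reports_step h k y :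
    let x := choose_point A h in
    let D := (choose_cut A h x).1 in
    let H := (choose_cut A h x).2 in
    argmax c (relaxation h) x -> ~ S x ->
    admissible_cut (relaxation h) x D H ->
    reports A (rcons h (Iteration x D H)) k y ->
    reports A h k.+1 y.

Definition solves_in (A : cp_strategy) (k : nat) : Prop :=
  exists x, reports A [::] k x /\ argmax c (C `&` S) x.

End CuttingPlanes.

Section BranchAndBound.
Context {R : realType} {n : nat}.

Inductive bb_tree := BBNode of set 'rV[R]_n & seq bb_tree.

Definition bb_label (t : bb_tree) : set 'rV[R]_n := let: BBNode C' _ := t in C'.

Fixpoint bb_nodes (t : bb_tree) : nat :=
  let: BBNode _ ts := t in (sumn (map bb_nodes ts)).+1.

Definition bb_size (t : bb_tree) : nat := (bb_nodes t).-1.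

Context (S : set 'rV[R]_n) (DD : set (disjunction S)).
Variables (c : 'rV[R]_n) (gamma : R) (C : set 'rV[R]_n).

Fixpoint bb_correct (t : bb_tree) : Prop :=
  let: BBNode C' ts := t in
  [/\ C' `<=` C, convex_set C',
      (if ts is [::] then valid_ineq c gamma C'
       else exists2 D, DD D &
              map bb_label ts = [seq C' `&` Q | Q <- pieces D])
    & foldr and True (map bb_correct ts)].

Definition bb_proof (t : bb_tree) : Prop := bb_label t = C /\ bb_correct t.

End BranchAndBound.

Section StableSets.
Context {R : realType}.

Definition edge_polytope n (e : rel 'I_n) : set 'rV[R]_n :=
  [set x | (forall u v, e u v -> x 0 u + x 0 v <= 1) /\
           (forall v, 0 <= x 0 v <= 1)].

(* m disjoint triangles: the j-th copy of K_3 has vertices 3j, 3j+1, 3j+2. *)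
Definition triangles m : rel 'I_(3 * m) :=
  [rel u v : 'I_(3 * m) | (u != v) && (u %/ 3 == v %/ 3)%N].

(* The objective x |-> \sum_v x_v. *)
Definition all_ones n : 'rV[R]_n := const_mx 1.

End StableSets.

(* Main.v *)
Require Import Defs.
From mathcomp Require Import all_boot all_order all_algebra.
From mathcomp Require Import all_classical all_reals all_analysis.
From mathcomp Require Import lra zify.

(** The relaxation overestimates each triangle independently: its three edge
constraints allow the sum 3/2, attained at (1/2, 1/2, 1/2), whereas an integral
point has sum at most 1.

A single cut repairs a triangle. If a corner is at most 0, the edge between the
two other corners bounds the sum by 1; if it is at least 1, its two edges force
the other corners down to 0. So the inequality saying that the triangle has sum
at most 1 is a cutting plane derived from a variable disjunction
([triangle_sum_le1], [clique_cut_cutting_plane]). Once the first k triangles are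
cut, one maximizer is a unit vector on each of them and 1/2 everywhere else
([nth_point_argmax]); it violates the cut of the next triangle, and it is
integral exactly when all m triangles are cut.

A branching, on the contrary, repairs a triangle only inside one subtree. The
lower bound is an adversary argument: follow a set F of free triangles, on the
complement of which a unit vector has been fixed, such that the node still
contains every point of the polytope with these fixed values. Branching on a
variable costs nothing unless it is the split of a corner of a free triangle
between 0 and 1, and then both children can be followed after fixing that one
triangle at a unit vector on the right side ([pinned_branch]). As long as F is
nonempty, 1/2 on F gives the value m + #|F|/2 > m, so the node is not a leaf.
Hence a node with F free has a subtree of at least 2 ^ (#|F| + 1) - 1 nodes
([bb_nodes_lower_bound]); at the root all m triangles are free. *)

Set Implicit Arguments.
Unset Strict Implicit.
Unset Printing Implicit Defensive.

Import Order.TTheory GRing.Theory Num.Theory.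

Local Open Scope classical_set_scope.
Local Open Scope ring_scope.

(** * Coordinates by triangle and corner *)

Section Coordinates.
Variable m : nat.

Lemma corner_subproof (j : 'I_m) (r : 'I_3) : (3 * j + r < 3 * m)%N.
Proof. by have := ltn_ord j; have := ltn_ord r; lia. Qed.

Definition corner (j : 'I_m) (r : 'I_3) : 'I_(3 * m) :=
  Ordinal (corner_subproof j r).

Lemma triangle_of_subproof (v : 'I_(3 * m)) : (v %/ 3 < m)%N.
Proof. by have := ltn_ord v; lia. Qed.

Definition triangle_of (v : 'I_(3 * m)) : 'I_m :=
  Ordinal (triangle_of_subproof v).

Definition corner_of (v : 'I_(3 * m)) : 'I_3 :=
  Ordinal (ltn_pmod v (isT : 0 < 3)%N).

Lemma cornerK v : corner (triangle_of v) (corner_of v) = v.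
Proof. by apply: val_inj => /=; lia. Qed.

Lemma triangle_of_corner j r : triangle_of (corner j r) = j.
Proof. by apply: val_inj => /=; have := ltn_ord r; lia. Qed.

Lemma corner_of_corner j r : corner_of (corner j r) = r.
Proof. by apply: val_inj => /=; have := ltn_ord r; lia. Qed.

Lemma triangles_corner j r j' r' :
  @triangles m (corner j r) (corner j' r') = (j == j') && (r != r').
Proof.
rewrite /triangles /= -!val_eqE /=.
by have := ltn_ord r; have := ltn_ord r'; lia.
Qed.

Lemma sum_corners (R : realType) (F : 'I_(3 * m) -> R) :
  \sum_v F v = \sum_j \sum_r F (corner j r).
Proof.
rewrite pair_big /= (reindex (fun p => corner p.1 p.2)) //=.
exists (fun v => (triangle_of v, corner_of v)) => [[j r] _|v _] /=.
  by rewrite triangle_of_corner corner_of_corner.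
exact: cornerK.
Qed.

End Coordinates.

(** * The edge polytope of disjoint triangles *)

Section Polytope.
Context {R : realType} {m : nat}.
Implicit Types (x : 'rV[R]_(3 * m)) (j : 'I_m) (r : 'I_3) (F : {set 'I_m}).
Implicit Types (s : 'I_m -> 'I_3).

Notation P := (edge_polytope (@triangles m) : set 'rV[R]_(3 * m)).

Definition triangle_sum x j : R := \sum_r x 0 (corner j r).

Lemma edge_polytope_trianglesP x :
  P x <-> forall j,
    (forall r r', r != r' -> x 0 (corner j r) + x 0 (corner j r') <= 1) /\
    (forall r, 0 <= x 0 (corner j r) <= 1).
Proof.
split=> [[xe x01] j|xP].
  by split=> // r r' rr'; apply: xe; rewrite triangles_corner eqxx.
split=> [u v|v].
  rewrite -(cornerK u) -(cornerK v) triangles_corner => /andP[/eqP <- uv].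
  exact: (xP _).1.
by rewrite -(cornerK v); exact: (xP _).2.
Qed.

Lemma dotp_all_ones x : dotp (all_ones (3 * m)) x = \sum_j triangle_sum x j.
Proof.
by rewrite -sum_corners; apply: eq_bigr => v _; rewrite mxE mul1r.
Qed.

Lemma triangle_sum_le_three_halves x j : P x -> triangle_sum x j <= 3 / 2.
Proof.
move=> /edge_polytope_trianglesP /(_ j)[xe _].
rewrite /triangle_sum !big_ord_recl big_ord0.
set a := x 0 _; set b := x 0 _; set d := x 0 _.
have ab : a + b <= 1 by exact: xe.
have ad : a + d <= 1 by exact: xe.
have bd : b + d <= 1 by exact: xe.
by lra.
Qed.

(** The disjunction on one corner alone suffices: at most 0, the opposite edge
bounds the sum; at least 1, the two incident edges leave nothing for the other
corners. *)
Lemma triangle_sum_le1 x j : P x ->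
  x 0 (corner j 0) <= 0 \/ 1 <= x 0 (corner j 0) -> triangle_sum x j <= 1.
Proof.
move=> /edge_polytope_trianglesP /(_ j)[xe x01].
rewrite /triangle_sum !big_ord_recl big_ord0.
set a := x 0 _; set b := x 0 _; set d := x 0 _.
have ab : a + b <= 1 by exact: xe.
have ad : a + d <= 1 by exact: xe.
have bd : b + d <= 1 by exact: xe.
have /andP[a0 a1] : 0 <= a <= 1 by exact: x01.
by case=> ?; lra.
Qed.

(** These points serve twice: as maximizers along the cutting plane run, with F
the triangles still uncut, and as witnesses that a branch-and-bound node is not
a leaf, with F the triangles still free. *)
Definition half_point F s : 'rV[R]_(3 * m) :=
  \row_v (if triangle_of v \in F then 2^-1
          else (corner_of v == s (triangle_of v))%:R).

Lemma half_pointE F s j r :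
  half_point F s 0 (corner j r) = if j \in F then 2^-1 else (r == s j)%:R.
Proof. by rewrite mxE triangle_of_corner corner_of_corner. Qed.

Lemma half_point_in F s : P (half_point F s).
Proof.
apply/edge_polytope_trianglesP => j; split=> [r r' rr'|r]; rewrite !half_pointE.
  case: ifP => _; first by lra.
  case: eqP => [rs|_]; case: eqP => [r's|_] /=; rewrite ?addr0 ?add0r //.
  by rewrite rs r's eqxx in rr'.
by case: ifP => _; [lra | case: eqP; rewrite ?lexx ler01].
Qed.

Lemma triangle_sum_half_point F s j :
  triangle_sum (half_point F s) j = if j \in F then 3 / 2 else 1.
Proof.
rewrite /triangle_sum (eq_bigr _ (fun r _ => half_pointE F s j r)).
case: ifP => _; first by rewrite !big_ord_recl big_ord0; lra.
by rewrite (bigD1 (s j)) //= eqxx big1 ?addr0 // => r /negPf ->.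
Qed.

End Polytope.

(** * The branch-and-bound lower bound *)

Section BranchAndBound.
Context {R : realType} {m : nat}.
Implicit Types (x : 'rV[R]_(3 * m)) (j : 'I_m) (r : 'I_3) (F : {set 'I_m}).
Implicit Types (s : 'I_m -> 'I_3) (t : bb_tree (R := R) (n := 3 * m)).

Notation P := (edge_polytope (@triangles m) : set 'rV[R]_(3 * m)).

(** The part of the polytope that the adversary keeps inside the current node.
Fixing whole triangles at unit vectors, rather than single variables, makes
every later branching on a fixed triangle harmless. *)
Definition pinned F s : set 'rV[R]_(3 * m) :=
  [set x | P x /\ forall j, j \notin F ->
                    forall r, x 0 (corner j r) = (r == s j)%:R].

Lemma half_point_pinned F s : pinned F s (half_point F s).
Proof.
by split=> [|j jF r]; [exact: half_point_in | rewrite half_pointE (negPf jF)].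
Qed.

Lemma dotp_half_point F s :
  dotp (all_ones (3 * m)) (half_point F s : 'rV[R]_(3 * m)) = m%:R + #|F|%:R / 2.
Proof.
rewrite dotp_all_ones (eq_bigr (fun j => 1 + (if j \in F then 2^-1 else 0))).
  rewrite big_split /= sumr_const card_ord -big_mkcond sumr_const.
  by rewrite [X in _ = _ + X]mulr_natl.
by move=> j _; rewrite triangle_sum_half_point; case: ifP => _; lra.
Qed.

Definition pin s j r : 'I_m -> 'I_3 := fun i => if i == j then r else s i.

Lemma pinned_pin F s j r : j \in F -> pinned (F :\ j) (pin s j r) `<=` pinned F s.
Proof.
move=> jF x [Px xs]; split=> // i iF q.
have ij : i != j by apply: contraNneq iF => ->.
by rewrite xs ?inE ?(negPf iF) ?andbF // /pin (negPf ij).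
Qed.

Lemma pinned_pinE F s j r x q : pinned (F :\ j) (pin s j r) x ->
  x 0 (corner j q) = (q == r)%:R.
Proof. by case=> _ ->; rewrite ?inE ?eqxx // /pin eqxx. Qed.

(** For K <> 0 one of the two pieces contains the whole interval from 0 to 1, and
on a fixed triangle the coordinates are integral; either way one child inherits
the pinned set unchanged. Only the split of a free triangle at K = 0 separates points, and
there both children still contain a unit vector on this triangle. *)
Lemma pinned_branch F s (v : 'I_(3 * m)) (K : int) :
  [\/ pinned F s `<=` [set x | x 0 v <= K%:~R],
      pinned F s `<=` [set x | (K + 1)%:~R <= x 0 v] |
      exists2 j, j \in F & exists r r',
        pinned (F :\ j) (pin s j r) `<=` [set x | x 0 v <= K%:~R] /\
        pinned (F :\ j) (pin s j r') `<=` [set x | (K + 1)%:~R <= x 0 v]].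
Proof.
rewrite -(cornerK v); move: (triangle_of v) (corner_of v) => j q.
have [K1|K1] := leP 1 K.
  apply: Or31 => x [/edge_polytope_trianglesP /(_ j)[_ /(_ q) /andP[_ x1]] _] /=.
  by rewrite (le_trans x1) // ler1z.
have [K0|K0] := ltP K 0.
  apply: Or32 => x [/edge_polytope_trianglesP /(_ j)[_ /(_ q) /andP[x0 _]] _] /=.
  by rewrite (le_trans _ x0) // lerz0 lezD1.
have -> : K = 0 by lia.
rewrite add0r; have [jF|jF] := boolP (j \in F); last first.
  have [qs|qs] := eqVneq q (s j); [apply: Or32 | apply: Or31] => x [_ xs] /=.
    by rewrite xs // qs eqxx.
  by rewrite xs // (negPf qs).
apply: Or33; exists j => //.
(* To keep corner q at 0, put the unit on another corner, q + 1 modulo 3. *)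
exists (q + 1), q; split=> x Fx /=; rewrite (pinned_pinE q Fx) ?eqxx //.
by rewrite -subr_eq0 opprD addNKr.
Qed.

(** Each branching that separates points uses up one free triangle but must be
answered in both subtrees, which doubles the count. *)
Lemma bb_nodes_lower_bound t F s :
  bb_correct (variable_disjunctions R (3 * m)) (all_ones (3 * m)) m%:R P t ->
  pinned F s `<=` bb_label t ->
  (2 ^ #|F|.+1 <= (bb_nodes t).+1)%N.
Proof.
(* Structural induction: trees nest through lists, so the generated induction
   principle gives no hypothesis on the children. *)
move: t F s; fix IH 1 => -[C' ts] F s /= [_ _ tsP tsc] FC'.
case: ts tsP tsc => [leafP _|t0 ts0].
  (* At a leaf the value m + #|F|/2 of this point is at most m. *)
  have := leafP _ (FC' _ (half_point_pinned F s)).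
  rewrite dotp_half_point gerDl => F0.
  have -> : #|F| = 0%N.
    by apply/eqP; rewrite -leqn0 -(ler_nat R); lra.
  by [].
move=> [_ [v [K ->]]] /=.
case: ts0 => [//|t1 [|//]] [l0 l1] /= [c0 [c1 _]].
case: (pinned_branch F s v K) => [F0|F1|[j jF [r [r' [F0 F1]]]]].
- have : pinned F s `<=` bb_label t0.
    by rewrite l0 => x Fx; split; [exact: FC' | exact: F0].
  move=> /(IH _ _ _ c0) /leq_trans; apply.
  by rewrite ltnS leqW // leq_addr.
- have : pinned F s `<=` bb_label t1.
    by rewrite l1 => x Fx; split; [exact: FC' | exact: F1].
  move=> /(IH _ _ _ c1) /leq_trans; apply.
  by rewrite ltnS addn0 leqW // leq_addl.
have /(IH _ _ _ c0) b0 : pinned (F :\ j) (pin s j r) `<=` bb_label t0.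
  by rewrite l0 => x Fx; split; [exact/FC'/(pinned_pin jF Fx) | exact: F0].
have /(IH _ _ _ c1) b1 : pinned (F :\ j) (pin s j r') `<=` bb_label t1.
  by rewrite l1 => x Fx; split; [exact/FC'/(pinned_pin jF Fx) | exact: F1].
rewrite (cardsD1 j F) jF add1n expnS mul2n -addnn.
apply: leq_trans (leq_add b0 b1) _; by rewrite addn0 addSn addnS.
Qed.

End BranchAndBound.

(** * Strategies with prescribed choices *)

Section Strategies.
Context {R : realType} {n : nat} (S : set 'rV[R]_n).
Variables (DD : set (disjunction S)) (c : 'rV[R]_n) (C : set 'rV[R]_n).

(** A strategy must obey the rules after every past, including those that no
intended run produces. Prescribed choices can be completed to such a strategy by
using them where they are legal and arbitrary legal choices elsewhere. *)
Lemma preferred_strategy (point : seq (iteration S) -> 'rV[R]_n)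
    (cut : seq (iteration S) -> disjunction S * set 'rV[R]_n) :
  exists A : cp_strategy S,
    [/\ follows_rules DD c C A,
        forall h, argmax c (relaxation C h) (point h) ->
          choose_point A h = point h &
        forall h x, admissible_cut DD (relaxation C h) x (cut h).1 (cut h).2 ->
          choose_cut A h x = cut h].
Proof.
have /choice[p pP] h : exists p,
    (argmax c (relaxation C h) !=set0 -> argmax c (relaxation C h) p) /\
    (argmax c (relaxation C h) (point h) -> p = point h).
  have [pt|npt] := pselect (argmax c (relaxation C h) (point h)).
    by exists (point h).
  have [[p ?]|np] := pselect (argmax c (relaxation C h) !=set0).
    by exists p; split => // /npt.
  by exists (point h).
have /choice[k kP] hx : exists d : disjunction S * set 'rV[R]_n,
    ((exists D, exists H, admissible_cut DD (relaxation C hx.1) hx.2 D H) ->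
       admissible_cut DD (relaxation C hx.1) hx.2 d.1 d.2) /\
    (admissible_cut DD (relaxation C hx.1) hx.2 (cut hx.1).1 (cut hx.1).2 ->
       d = cut hx.1).
  have [ct|nct] :=
      pselect (admissible_cut DD (relaxation C hx.1) hx.2 (cut hx.1).1 (cut hx.1).2).
    by exists (cut hx.1).
  have [[D [H DH]]|nd] := pselect (exists D, exists H,
      admissible_cut DD (relaxation C hx.1) hx.2 D H).
    by exists (D, H); split => // /nct.
  by exists (cut hx.1); split.
exists (CPStrategy p (fun h x => k (h, x))); split=> [h|h|h x] /=.
- by split=> [|x _ _]; [exact: (pP h).1 | exact: (kP (h, x)).1].
- exact: (pP h).2.
- exact: (kP (h, x)).2.
Qed.

End Strategies.

(** * Cutting one triangle per iteration *)

Section TriangleCuts.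
Context {R : realType} {m : nat}.
Variable j0 : 'I_m.
Implicit Types (x : 'rV[R]_(3 * m)) (j : 'I_m) (k : nat).

Notation P := (edge_polytope (@triangles m) : set 'rV[R]_(3 * m)).
Notation ones := (all_ones (3 * m) : 'rV[R]_(3 * m)).
Notation DD := (variable_disjunctions R (3 * m)).

Definition triangle_normal j : 'rV[R]_(3 * m) := \row_v (triangle_of v == j)%:R.

Lemma dotp_triangle_normal j x : dotp (triangle_normal j) x = triangle_sum x j.
Proof.
rewrite /dotp sum_corners (bigD1 j) //= [X in _ + X]big1 ?addr0 => [|i ij].
  by apply: eq_bigr => r _; rewrite mxE triangle_of_corner eqxx mul1r.
by rewrite big1 // => r _; rewrite mxE triangle_of_corner (negPf ij) mul0r.
Qed.

Definition clique_cut j : set 'rV[R]_(3 * m) := [set x | triangle_sum x j <= 1].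

Lemma clique_cut_halfspace j : is_halfspace (clique_cut j).
Proof.
exists (triangle_normal j), 1; split.
  apply/eqP => /rowP /(_ (corner j 0)) /eqP.
  by rewrite !mxE triangle_of_corner eqxx oner_eq0.
by apply/seteqP; split=> x /=; rewrite dotp_triangle_normal.
Qed.

Lemma clique_cut_cutting_plane C' j : C' `<=` P ->
  cutting_plane C' (variable_disjunction (corner j 0) 0) (clique_cut j).
Proof.
move=> C'P; split; first exact: clique_cut_halfspace.
move=> x [/C'P Px]; rewrite /union_of /= !big_cons big_nil setU0 => xD.
exact: triangle_sum_le1.
Qed.

(** The default j0 is taken only for k >= m, where no cut is made any more. *)
Definition nth_triangle k : 'I_m := insubd j0 k.

Definition nth_point k : 'rV[R]_(3 * m) :=
  half_point [set j : 'I_m | (k <= j)%N] (fun=> 0).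

Definition nth_cut k : disjunction (int_points R (3 * m)) * set 'rV[R]_(3 * m) :=
  (variable_disjunction (corner (nth_triangle k) 0) 0, clique_cut (nth_triangle k)).

Definition clique_history k : seq (iteration (int_points R (3 * m))) :=
  mkseq (fun i => Iteration (nth_point i) (nth_cut i).1 (nth_cut i).2) k.

Lemma relaxation_clique_history k : (k <= m)%N ->
  relaxation P (clique_history k) =
  [set x | P x /\ forall j, (j < k)%N -> triangle_sum x j <= 1].
Proof.
rewrite /relaxation /clique_history.
elim: k => [_|k IH km]; first by apply/seteqP; split=> x //= -[].
rewrite mkseqS foldl_rcons IH ?(ltnW km) //=.
have kE : nth_triangle k = k :> nat by rewrite val_insubd km.
apply/seteqP; split=> x /= => [[[Px xk] xc]|[Px xk]].
  split=> // j; rewrite ltnS leq_eqVlt => /orP[/eqP jk|]; last exact: xk.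
  suff -> : j = nth_triangle k by [].
  by apply: val_inj; rewrite /= kE.
split; last by apply: xk; rewrite kE.
by split=> // j jk; apply: xk; rewrite ltnS ltnW.
Qed.

(** Optimality is seen triangle by triangle: 1 is the bound imposed on a cut
triangle, 3/2 the bound that the edges impose on an uncut one. *)
Lemma nth_point_argmax k : (k <= m)%N ->
  argmax ones (relaxation P (clique_history k)) (nth_point k).
Proof.
move=> km; rewrite relaxation_clique_history //; split=> [|y [Py yk]] /=.
  split=> [|j jk]; first exact: half_point_in.
  by rewrite triangle_sum_half_point inE leqNgt jk.
rewrite !dotp_all_ones; apply: ler_sum => j _.
rewrite triangle_sum_half_point inE; case: leqP => jk; last exact: yk.
exact: triangle_sum_le_three_halves.
Qed.

Lemma nth_cut_admissible k : (k < m)%N ->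
  admissible_cut DD (relaxation P (clique_history k)) (nth_point k)
    (nth_cut k).1 (nth_cut k).2.
Proof.
move=> km; split=> /=; first by exists (corner (nth_triangle k) 0), 0.
  apply: clique_cut_cutting_plane.
  by rewrite relaxation_clique_history ?(ltnW km) // => x [].
rewrite /clique_cut /= triangle_sum_half_point inE val_insubd km leqnn.
by apply/negP; rewrite -ltNge; lra.
Qed.

Lemma nth_point_frac k : (k < m)%N -> ~ int_points R (3 * m) (nth_point k).
Proof.
move=> km /(_ (corner (Ordinal km) 0)); rewrite half_pointE inE leqnn.
move=> /intrP[z hz].
(* 1/2 = z would make 1 an even integer. *)
have : (2 * z)%:~R = 1%:~R :> R by rewrite intrM -hz; lra.
by move=> /intr_inj; lia.
Qed.

Lemma nth_point_int : int_points R (3 * m) (nth_point m).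
Proof.
move=> v; rewrite -(cornerK v) half_pointE inE leqNgt ltn_ord /=.
exact: natr_int.
Qed.

Lemma clique_strategy :
  exists A : cp_strategy (int_points R (3 * m)),
    follows_rules DD ones P A /\ solves_in DD ones P A m.
Proof.
have [A [rules pointA cutA]] := preferred_strategy DD ones P
  (fun h => nth_point (size h)) (fun h => nth_cut (size h)).
exists A; split=> //; exists (nth_point m).
have szh k : size (clique_history k) = k by rewrite size_mkseq.
have pA k : (k <= m)%N -> choose_point A (clique_history k) = nth_point k.
  by move=> km; rewrite pointA szh //; exact: nth_point_argmax.
split; last first.
  split=> [|y [Py yS]]; first by split; [exact: half_point_in | exact: nth_point_int].
  (* Integral points satisfy every cut, so they lie in the last relaxation. *)
  apply: (nth_point_argmax (leqnn m)).2.
  rewrite relaxation_clique_history //; split=> // j _.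
  have /= /intrP[z zE] := yS (corner j 0).
  apply: triangle_sum_le1 => //; rewrite zE lerz0 ler1z.
  by case: (leP z 0) => z0; [left | right].
suff runs d k : (k + d)%N = m ->
    reports DD ones P A (clique_history k) d (nth_point m).
  exact: (runs m 0%N).
elim: d k => [k|d IH k kd].
  rewrite addn0 => ->.
  rewrite -[X in reports _ _ _ _ _ _ X](pA m) //.
  by apply: reports_stop; rewrite pA //; [exact: nth_point_argmax | exact: nth_point_int].
have km : (k < m)%N by lia.
have cA : choose_cut A (clique_history k) (nth_point k) = nth_cut k.
  by rewrite cutA szh //; exact: nth_cut_admissible.
apply: reports_step; rewrite (pA _ (ltnW km)) ?cA.
- exact: nth_point_argmax (ltnW km).
- exact: nth_point_frac.
- exact: nth_cut_admissible.
- by have := IH k.+1; rewrite /clique_history mkseqS; apply; rewrite addSnnS.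
Qed.

End TriangleCuts.

Theorem theorem2p2 (R : realType) (m : nat) (hm : (1 <= m)%N) :
  let C : set 'rV[R]_(3 * m) := edge_polytope (@triangles m) in
  let c : 'rV[R]_(3 * m) := all_ones (3 * m) in
  let DD := variable_disjunctions R (3 * m) in
  (exists A : cp_strategy (int_points R (3 * m)),
      follows_rules DD c C A /\ solves_in DD c C A m) /\
  (forall t : bb_tree,
      bb_proof DD c (m%:R)%R C t -> (2 ^ m.+1 - 2 <= bb_size t)%N).
Proof.
split; first exact: (clique_strategy (Ordinal hm)).
move=> t [tC /bb_nodes_lower_bound tP].
have := tP [set: 'I_m]%SET (fun=> 0); rewrite tC cardsT card_ord => tm.
by have := tm (fun x => @proj1 _ _); rewrite /bb_size; lia.
Qed.
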